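(* Let $r>0$ be an integer and let $V(f)\subset\mathbb{P}^n$ be a hypersurface, where $f\in\mathbb{C}[x_0,\ldots,x_n]$ is a square-free homogeneous polynomial. The defining equation $f^{\circ r}$ of its coordinate-wise $r$-th power $V(f)^{\circ r}$ is given (up to scaling) by replacing each occurrence of $x_i^r$ in $\mathfrak{s}_r(f)$ by $x_i$, for all $i\in\{0,1,\ldots,n\}$.
   Context: We work over $\mathbb{C}$; polynomials are considered up to non-zero scalars, and $\mathbb{C}[\mathbf{x}]:=\mathbb{C}[x_0,\ldots,x_n]$. A hypersurface is a (reduced) pure codimension-1 variety in $\mathbb{P}^n$, possibly reducible. For a variety $X\subset\mathbb{P}^n$, $X^{\circ r}:=\varphi_r(X)$ where $\varphi_r\colon\mathbb{P}^n\to\mathbb{P}^n$, $[x_0:\ldots:x_n]\mapsto[x_0^r:\ldots:x_n^r]$. For square-free $f$, $V(f)^{\circ r}$ is again a hypersurface and $f^{\circ r}$ denotes its square-free defining polynomial (unique up to scaling), i.e. $V(f^{\circ r})=V(f)^{\circ r}$. Let $\mathbb{Z}_r$ be the group of $r$-th roots of unity and $\mathcal{G}_r:=\mathbb{Z}_r^{n+1}/\mathbb{Z}_r$ (quotient by the diagonal), acting on $\mathbb{P}(\mathbb{C}[\mathbf{x}]_d)$ by rescaling the variables $x_0,\ldots,x_n$ by $r$-th roots of unity. For square-free $f\in\mathbb{P}(\mathbb{C}[\mathbf{x}]_d)$, define $\mathfrak{s}_r(f)$ (up to scaling) as follows: (i) if $f$ is irreducible and $f\ne x_i$ for all $i$,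 then $\mathfrak{s}_r(f)$ is the product over the elements of the orbit $\mathcal{G}_r\cdot f\subset\mathbb{P}(\mathbb{C}[\mathbf{x}]_d)$ (each element of the orbit taken once); if $f=x_i$, then $\mathfrak{s}_r(f):=x_i^r$; (ii) if $f=f_1f_2\cdots f_m$ with $f_i$ irreducible, then $\mathfrak{s}_r(f):=\mathrm{lcm}\{\mathfrak{s}_r(f_1),\ldots,\mathfrak{s}_r(f_m)\}$. One has $\mathfrak{s}_r(f)\in\mathbb{C}[x_0^r,\ldots,x_n^r]$, so the replacement of $x_i^r$ by $x_i$ makes sense. *)

(* Defs.v *)
From HB Require Import structures.
From mathcomp Require Import all_boot all_order all_algebra generic_quotient.
From mathcomp Require Import classical_sets.
From mathcomp Require Import mpoly.

Set Implicit Arguments.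
Unset Strict Implicit.
Unset Printing Implicit Defensive.

Import GRing.Theory Num.Theory.
Local Open Scope ring_scope.
Local Open Scope quotient_scope.

Section ProjectiveSpace.
Variables (K : fieldType) (n : nat).

Definition hvec := {x : 'rV[K]_n.+1 | x != 0}.

(* Two homogeneous coordinate vectors are equivalent iff they span the same
   line, i.e. iff they have the same row space. *)
Definition hvec_eq (x y : hvec) : bool := (val x == val y)%MS.

Lemma hvec_eq_refl : reflexive hvec_eq.
Proof. by move=> x; rewrite /hvec_eq submx_refl. Qed.

Lemma hvec_eq_sym : ssrbool.symmetric hvec_eq.
Proof. by move=> x y; rewrite /hvec_eq andbC. Qed.

Lemma hvec_eq_trans : transitive hvec_eq.
Proof.
move=> y x z /andP[xy yx] /andP[yz zy].
by apply/andP; split; [exact: submx_trans xy yz | exact: submx_trans zy yx].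
Qed.

Canonical hvec_equiv := EquivRel hvec_eq hvec_eq_refl hvec_eq_sym hvec_eq_trans.

Definition proj := {eq_quot hvec_equiv}.
HB.instance Definition _ := Choice.on proj.
HB.instance Definition _ := EqQuotient.on proj.

Lemma hvec_eqP (x y : hvec) :
  reflect (exists2 c : K, c != 0 & val x = c *: val y) (hvec_eq x y).
Proof.
apply: (iffP andP) => [[/sub_rVP[c xy] _]|[c c0 xy]].
  exists c => //; apply: contraTneq (valP x) => c0.
  by rewrite xy c0 scale0r eqxx.
by rewrite xy; split; [exact: scalemx_sub | rewrite eqmx_scale].
Qed.

Lemma pow_row_neq0 (r : nat) (x : hvec) :
  (\row_i (val x 0 i ^+ r)) != 0 :> 'rV[K]_n.+1.
Proof.
apply: contra (valP x) => /eqP/rowP e; apply/eqP/rowP => i; rewrite mxE.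
by move: (e i); rewrite !mxE => /eqP; rewrite expf_eq0 => /andP[_ /eqP].
Qed.

Definition hvec_pow (r : nat) (x : hvec) : hvec :=
  exist _ (\row_i (val x 0 i ^+ r)) (pow_row_neq0 r x).

Definition coord_pow (r : nat) (p : proj) : proj := \pi_proj (hvec_pow r (repr p)).

Lemma coord_pow_pi (r : nat) (x : hvec) :
  coord_pow r (\pi_proj x) = \pi_proj (hvec_pow r x).
Proof.
apply/eqmodP; rewrite /=; have /eqmodP/hvec_eqP[c c0 e] := reprK (\pi_proj x).
apply/hvec_eqP; exists (c ^+ r); first by rewrite expf_neq0.
by rewrite /= e; apply/rowP => i; rewrite !mxE exprMn.
Qed.

(* For homogeneous [f] the condition does not depend on the representative. *)
Definition zero_locus (f : {mpoly K[n.+1]}) : set proj :=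
  [set p : proj | f.@[val (repr p) 0] = 0].

End ProjectiveSpace.

Section Polynomials.
Variables (K : fieldType) (n : nat).
Implicit Types f g h p q s t : {mpoly K[n]}.

(* Equality in the projectivisation of the space of polynomials. *)
Definition scaled f g : Prop := exists2 c : K, c != 0 & f = c *: g.

Definition mdvd p q : Prop := exists k, q = k * p.

Definition mirreducible p : Prop :=
  [/\ p != 0, p \isn't a GRing.unit &
      forall a b, p = a * b -> a \is a GRing.unit \/ b \is a GRing.unit].

Definition square_free f : Prop :=
  forall p, mdvd (p ^+ 2) f -> p \is a GRing.unit.

Definition is_lcm (m : nat) (q : 'I_m -> {mpoly K[n]}) s : Prop :=
  (forall i, mdvd (q i) s) /\
  (forall t, (forall i, mdvd (q i) t) -> mdvd s t).

Definition hypersurface_eq f : Prop :=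
  square_free f /\ exists2 d : nat, (0 < d)%N & f \is d.-homog.

Definition rescale (a : 'I_n -> K) f : {mpoly K[n]} :=
  f \mPo [tuple a i *: 'X_i | i < n].

Definition subst_pow (r : nat) f : {mpoly K[n]} :=
  f \mPo [tuple 'X_i ^+ r | i < n].

Definition root_vector (r : nat) (a : 'I_n -> K) : Prop :=
  forall i, a i ^+ r = 1.

(* [l] lists one representative of each element of the orbit of the class of
   [f] under rescaling of the variables by [r]-th roots of unity.  The diagonal
   acts trivially on classes of homogeneous polynomials, so this is the orbit
   under the quotient by the diagonal as well. *)
Definition orbit_list (r : nat) f (l : seq {mpoly K[n]}) : Prop :=
  [/\ uniq l,
      {in l &, forall g h, scaled g h -> g = h},
      {in l, forall g, exists2 a, root_vector r a & g = rescale a f} &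
      forall a, root_vector r a -> exists2 g, g \in l & scaled g (rescale a f)].

Variant is_sr_irr (r : nat) f s : Prop :=
| SrVariable i of scaled f 'X_i & scaled s ('X_i ^+ r)
| SrOrbit l of (forall i, ~ scaled f 'X_i) & orbit_list r f l &
    scaled s (\prod_(g <- l) g).

(* [is_sr r f s] : [s] is, up to scaling, the polynomial s_r(f). *)
Definition is_sr (r : nat) f s : Prop :=
  exists (m : nat) (f_ s_ : 'I_m -> {mpoly K[n]}),
    [/\ forall i, mirreducible (f_ i), f = \prod_i f_ i,
        forall i, is_sr_irr r (f_ i) (s_ i) & is_lcm s_ s].

End Polynomials.

(* [h] is a square-free defining polynomial of the image of V(f) under the
   coordinate-wise [r]-th power map. *)
Definition is_coord_power (K : fieldType) (n r : nat) (f h : {mpoly K[n.+1]}) :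
    Prop :=
  hypersurface_eq h /\
  zero_locus h = image (zero_locus f) (@coord_pow K n r).

(* Main.v *)
(** Polynomials over a field form a factorial domain (Gauss, by induction on the
    number of variables), and over an algebraically closed field a prime [p]
    divides every [q] vanishing on its zeros: otherwise [p] and [q] are coprime
    as polynomials in the last variable, a Bezout relation gives a nonzero [m] in
    the other variables that vanishes wherever [p] and [q] have a common zero,
    and a generic choice of the other variables contradicts this.  Hence
    square-free polynomials with the same zeros are associated.

    Pick representatives [x], up to scaling, of the orbits of all factors of [f],
    and let [T] be the product of the [x ^+ e x], where [e x = r] if [x] is a
    variable and [e x = 1] otherwise.  Then [T] is s_r(f).  Being a least common
    multiple, [T] is invariant up to scalars under rescaling by r-th roots of
    unity, so all exponents of a given variable in [T] agree modulo [r]; one of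
    them is [0] or [r], because a variable divides [T] with multiplicity [0] or
    [r].  So [T = g(x^r)].  A square factor of [g] would give a prime of
    multiplicity at least 2 in [T], i.e. a variable, of multiplicity at least
    [2 r].  Finally [T] vanishes exactly on the union of the rescalings of V(f),
    i.e. on the preimage of the image of V(f) under the power map. *)

From HB Require Import structures.
Require Import Defs.
From mathcomp Require Import all_boot all_order all_algebra generic_quotient.
From mathcomp Require Import cyclic separable cyclotomic ring.
From mathcomp Require Import boolp classical_sets reals complex mpoly.

Set Implicit Arguments.
Unset Strict Implicit.
Unset Printing Implicit Defensive.

Import GRing.Theory Num.Theory.
Local Open Scope ring_scope.
Local Open Scope quotient_scope.

(** * Divisibility and prime elements *)

Section Divisibility.
Variable D : idomainType.
Implicit Types (a b c p q x y : D) (l : seq D).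

(* On multivariate polynomials, [dvdr] is convertible to [mdvd]. *)
Definition dvdr a b : Prop := exists k, b = k * a.

Definition prime_elt p : Prop :=
  [/\ p != 0, p \isn't a GRing.unit &
      forall a b, dvdr p (a * b) -> dvdr p a \/ dvdr p b].

Lemma dvdr_refl a : dvdr a a.
Proof. by exists 1; rewrite mul1r. Qed.

Lemma dvdr_trans b a c : dvdr a b -> dvdr b c -> dvdr a c.
Proof. by move=> [k ->] [j ->]; exists (j * k); rewrite mulrA. Qed.

Lemma dvdr_mull a b c : dvdr a c -> dvdr a (b * c).
Proof. by move=> [k ->]; exists (b * k); rewrite mulrA. Qed.

Lemma dvdr_mulr a b c : dvdr a b -> dvdr a (b * c).
Proof. by rewrite mulrC; apply: dvdr_mull. Qed.

Lemma dvdr_mul a b c d : dvdr a b -> dvdr c d -> dvdr (a * c) (b * d).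
Proof. by move=> [k ->] [j ->]; exists (k * j); rewrite mulrACA. Qed.

Lemma dvdr_exp n a b : dvdr a b -> dvdr (a ^+ n) (b ^+ n).
Proof. by move=> [k ->]; exists (k ^+ n); rewrite exprMn. Qed.

Lemma dvdr_pmul2l c a b : c != 0 -> dvdr (c * a) (c * b) -> dvdr a b.
Proof. by move=> c0 [k e]; exists k; apply: (mulfI c0); rewrite e mulrCA. Qed.

Lemma dvdr_unit a b : b \is a GRing.unit -> dvdr a b -> a \is a GRing.unit.
Proof. by move=> ub [k e]; move: ub; rewrite e unitrM => /andP[]. Qed.

Lemma dvdr_unitl a b : a \is a GRing.unit -> dvdr a b.
Proof. by move=> ua; exists (b / a); rewrite divrK. Qed.

Lemma dvdr_unit_mul u a b : u \is a GRing.unit -> dvdr a (u * b) -> dvdr a b.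
Proof. by move=> uu [k e]; exists (u^-1 * k); rewrite -mulrA -e mulKr. Qed.

Lemma dvdr_prod_mem l (F : D -> D) x :
  x \in l -> dvdr (F x) (\prod_(y <- l) F y).
Proof. by move=> xl; rewrite (big_rem x) //=; apply/dvdr_mulr/dvdr_refl. Qed.

(** If [q = k * p], the prime [q] divides [k] or [p]. In the first case cancelling [q] gives an
    inverse of [p], which is excluded. *)
Lemma prime_dvd_sym p q : prime_elt q -> p \isn't a GRing.unit ->
  dvdr p q -> dvdr q p.
Proof.
move=> [q0 _ pq] up [k e]; have [|[j ek]|//] := pq k p.
  by rewrite -e; apply: dvdr_refl.
case/negP: up; apply/unitrP; exists j.
by rewrite mulrC; split; apply: (mulfI q0); rewrite mulr1 {2}e ek; ring.
Qed.

Lemma prime_dvd_exp p n a : prime_elt p -> dvdr p (a ^+ n) -> dvdr p a.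
Proof.
move=> [p0 up pp]; elim: n => [|n IHn]; last by rewrite exprS => /pp[|/IHn].
by rewrite expr0 => /(dvdr_unit (unitr1 _)) u; rewrite u in up.
Qed.

Lemma prime_dvd_prod p l (F : D -> D) : prime_elt p ->
  dvdr p (\prod_(x <- l) F x) -> exists2 x, x \in l & dvdr p (F x).
Proof.
move=> [p0 up pp]; elim: l => [|x l IHl].
  by rewrite big_nil => /(dvdr_unit (unitr1 _)) u; rewrite u in up.
rewrite big_cons => /pp[h|/IHl[y yl h]]; first by exists x; rewrite ?mem_head.
by exists y; rewrite // in_cons yl orbT.
Qed.

(** Each copy of [p] must come out of [a], so the copies are cancelled one at a time. *)
Lemma prime_exp_cancel p n a b : prime_elt p -> ~ dvdr p b ->
  dvdr (p ^+ n) (a * b) -> dvdr (p ^+ n) a.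
Proof.
move=> pp nb; elim: n a => [|n IHn] a; first by move=> _; exists a; rewrite mulr1.
move=> [k e]; have [p0 _ /(_ a b)[|[j ej]|//]] := pp.
  by rewrite e exprS mulrCA; apply/dvdr_mulr/dvdr_refl.
rewrite ej exprSr; apply: dvdr_mul (dvdr_refl _); apply: IHn.
by exists k; apply: (mulfI p0); rewrite mulrA [p * j]mulrC -ej e exprS mulrCA.
Qed.

(** Between primes divisibility already means association, so on a list of primes this says that
    distinct members are not associated. *)
Definition nonassoc l : Prop := {in l &, forall x y, dvdr x y -> x = y}.

(** After division by the power of the head [x], the powers of the other primes still divide the
    quotient by [prime_exp_cancel], since none of these primes divides [x]. *)
Lemma prod_prime_exp_dvd l (e : D -> nat) a : uniq l ->
    {in l, forall x, prime_elt x} -> nonassoc l ->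
    {in l, forall x, dvdr (x ^+ e x) a} ->
  dvdr (\prod_(x <- l) x ^+ e x) a.
Proof.
elim: l a => [|x l IHl] a; first by move=> *; rewrite big_nil; exists a; rewrite mulr1.
move=> /= /andP[xl ul] pl nl dl; rewrite big_cons.
have [k ek] := dl x (mem_head _ _); rewrite ek [k * _]mulrC.
apply: dvdr_mul (dvdr_refl _) _; apply: IHl => // [y yl|y z yl zl|y yl].
- by apply: pl; rewrite in_cons yl orbT.
- by apply: nl; rewrite in_cons ?yl ?zl orbT.
have yl' : y \in x :: l by rewrite in_cons yl orbT.
apply: (@prime_exp_cancel y _ _ (x ^+ e x)); first exact: pl.
  move=> /(prime_dvd_exp (pl y yl'))/(nl y x yl' (mem_head _ _)) yx.
  by rewrite -yx yl in xl.
by rewrite -ek; apply: dl.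
Qed.

(** A prime divides at most one member of such a list, so its whole multiplicity in the product
    comes from that member. *)
Lemma prime_exp_dvd_prod l (e : D -> nat) p n : uniq l ->
    {in l, forall x, prime_elt x} -> nonassoc l -> prime_elt p -> (0 < n)%N ->
    dvdr (p ^+ n) (\prod_(x <- l) x ^+ e x) ->
  exists x, [/\ x \in l, dvdr p x & (n <= e x)%N].
Proof.
move=> ul pl nl pp n0; have [_ up _] := pp; elim: l ul pl nl => [|x l IHl].
  move=> _ _ _; rewrite big_nil => /(dvdr_unit (unitr1 _)).
  by rewrite unitrX_pos // => u; rewrite u in up.
move=> /= /andP[xl ul] pl nl; rewrite big_cons => dv.
have pl' : {in l, forall x, prime_elt x}.
  by move=> y yl; apply: pl; rewrite in_cons yl orbT.
have nl' : nonassoc l by move=> y z yl zl; apply: nl; rewrite in_cons ?yl ?zl orbT.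
have px := pl x (mem_head _ _); have [x0 ux _] := px.
have [dx|ndx] := pselect (dvdr p x); last first.
  have [|y [yl dy le]] := IHl ul pl' nl'.
    move: dv; rewrite mulrC; apply: prime_exp_cancel => //.
    by move/(prime_dvd_exp pp).
  by exists y; rewrite in_cons yl orbT.
have xp := prime_dvd_sym px up dx; exists x; split=> //; first exact: mem_head.
have {dv}dv : dvdr (x ^+ n) (x ^+ e x).
  apply: (dvdr_trans (dvdr_exp n xp)); apply: (prime_exp_cancel pp _ dv).
  move=> /(prime_dvd_prod pp)[y yl /(prime_dvd_exp pp) dy].
  have yl' : y \in x :: l by rewrite in_cons yl orbT.
  have xy : x = y by apply: nl (dvdr_trans xp dy); rewrite // mem_head.
  by rewrite xy yl in xl.
(* If [e x < n], then [x ^+ (e x).+1] divides [x ^+ e x], and cancelling makes [x] a unit. *)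
rewrite leqNgt; apply: contra ux => lt; apply: (@dvdr_unit _ 1) (unitr1 _) _.
apply: (@dvdr_pmul2l (x ^+ e x)); first by rewrite expf_neq0.
rewrite mulr1 -exprSr; apply: dvdr_trans dv.
by exists (x ^+ (n - (e x).+1)); rewrite -exprD subnK.
Qed.

(** Asking for prime rather than irreducible factors makes uniqueness of the factorization
    automatic. *)
Definition factorial_domain : Prop := forall a, a != 0 ->
  exists u l, [/\ u \is a GRing.unit, {in l, forall x, prime_elt x} &
                  a = u * \prod_(x <- l) x].

Lemma prime_irreducible p : prime_elt p -> forall a b, p = a * b ->
  a \is a GRing.unit \/ b \is a GRing.unit.
Proof.
move=> pp a b e; have [p0 up _] := pp; have [ub|ub] := boolP (b \is a GRing.unit).
  by right.
left; have [|j ej] := prime_dvd_sym pp ub; first by exists a.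
apply/unitrP; exists j; suff ja : j * a = 1 by rewrite [a * j]mulrC.
by apply: (mulIf p0); rewrite mul1r {2}e ej; ring.
Qed.

Hypothesis fD : factorial_domain.

Lemma irreducible_prime p : p != 0 -> p \isn't a GRing.unit ->
    (forall a b, p = a * b -> a \is a GRing.unit \/ b \is a GRing.unit) ->
  prime_elt p.
Proof.
move=> p0 up ip; have [u [l [uu pl e]]] := fD p0.
case: l pl e => [|x l] pl e; first by rewrite e big_nil mulr1 uu in up.
have px := pl x (mem_head _ _); have [x0 ux dx] := px.
rewrite big_cons mulrCA in e; have [|ul] := ip _ _ e; first by rewrite (negbTE ux).
split=> // a b pab; have [|xa|xb] := dx a b.
- by apply: dvdr_trans pab; rewrite e; apply/dvdr_mulr/dvdr_refl.
- left; apply: dvdr_trans xa; rewrite e.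
  by exists (u * \prod_(j <- l) j)^-1; rewrite mulrC mulrK.
- right; apply: dvdr_trans xb; rewrite e.
  by exists (u * \prod_(j <- l) j)^-1; rewrite mulrC mulrK.
Qed.

Lemma exists_prime_dvd a : a != 0 -> a \isn't a GRing.unit ->
  exists2 p, prime_elt p & dvdr p a.
Proof.
move=> a0 ua; have [u [l [uu pl e]]] := fD a0.
case: l pl e => [|x l] pl e; first by rewrite e big_nil mulr1 uu in ua.
exists x; first by apply: pl; rewrite mem_head.
by rewrite e big_cons; apply/dvdr_mull/dvdr_mulr/dvdr_refl.
Qed.

(** A prime factor [x] of [a] is removed from both [a] and [b]. A prime [p] of the rest of [a] still
    divides the quotient of [b]: otherwise [p] divides [x], and [p ^+ 2] divides [a]. *)
Lemma squarefree_dvd a b : a != 0 ->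
    (forall p, prime_elt p -> ~ dvdr (p ^+ 2) a) ->
    (forall p, prime_elt p -> dvdr p a -> dvdr p b) ->
  dvdr a b.
Proof.
move=> a0; have [u [l [uu pl ->]]] := fD a0 => {a a0}.
elim: l b pl => [|x l IHl] b pl sf ab.
  by rewrite big_nil mulr1; apply: dvdr_unitl.
have px := pl x (mem_head _ _); have [x0 ux _] := px.
rewrite big_cons mulrCA in sf ab *.
have [|k e] := ab x px; first by apply/dvdr_mulr/dvdr_refl.
rewrite e [k * x]mulrC; apply: dvdr_mul (dvdr_refl _) _; apply: IHl.
- by move=> y yl; apply: pl; rewrite in_cons yl orbT.
- by move=> p pp dp; apply: (sf p pp); apply: dvdr_mull.
move=> p pp dp; have [_ up /(_ k x)[|//|dx]] := pp.
  by rewrite -e; apply: ab => //; apply: dvdr_mull.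
have xp := prime_dvd_sym px up dx.
by case: (sf p pp); rewrite expr2; apply: dvdr_mul.
Qed.

End Divisibility.

(** * Transfer of primes and factoriality along ring isomorphisms *)

Section Transfer.
Variables (A B : idomainType) (phi : {rmorphism A -> B}) (psi : {rmorphism B -> A}).
Hypotheses (phiK : cancel phi psi) (psiK : cancel psi phi).

Lemma dvdr_morph (S T : idomainType) (h : {rmorphism S -> T}) a b :
  dvdr a b -> dvdr (h a) (h b).
Proof. by move=> [k ->]; exists (h k); rewrite rmorphM. Qed.

Lemma iso_prime p : prime_elt p -> prime_elt (phi p).
Proof.
move=> [p0 up pp]; split; first by rewrite -(rmorph0 phi) (can_eq phiK).
  by apply: contra up => /(rmorph_unit psi); rewrite phiK.
move=> a b /(dvdr_morph psi); rewrite phiK rmorphM => /pp[] /(dvdr_morph phi).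
  by rewrite psiK; left.
by rewrite psiK; right.
Qed.

End Transfer.

Lemma iso_factorial (A B : idomainType) (phi : {rmorphism A -> B})
    (psi : {rmorphism B -> A}) : cancel phi psi -> cancel psi phi ->
  factorial_domain A -> factorial_domain B.
Proof.
move=> phiK psiK fA b b0; have [|u [l [uu pl e]]] := fA (psi b).
  by rewrite -(rmorph0 psi) (can_eq psiK).
exists (phi u), (map phi l); split; first exact: rmorph_unit.
  by move=> _ /mapP[x xl ->]; apply: (iso_prime phiK psiK); apply: pl.
by rewrite big_map -rmorph_prod -rmorphM -e psiK.
Qed.

(** * Gauss's lemma *)

Section PolyFactorial.
Variable D : idomainType.
Implicit Types (c : D) (f g h : {poly D}).

Lemma polyC_unit c : (c%:P \is a GRing.unit) = (c \is a GRing.unit).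
Proof.
rewrite poly_unitE coefC eqxx size_polyC; have [->|] //= := eqVneq c 0.
by rewrite unitr0.
Qed.

Lemma dvdr_polyCP c f : dvdr c%:P f <-> forall i, dvdr c f`_i.
Proof.
split=> [[k ->] i|dv]; first by exists k`_i; rewrite coefMC.
have /boolp.choice[k ek] := dv; exists (\poly_(i < size f) k i).
apply/polyP => i; rewrite coefMC coef_poly; case: ltnP => [_|le]; first exact: ek.
by rewrite mul0r nth_default.
Qed.

(** Let [i] and [j] be the least indices at which [c] fails to divide a coefficient of [f] and [g].
    The coefficient of [f * g] at [i + j] is the product of these two plus multiples of [c]. *)
Lemma polyC_prime c : prime_elt c -> prime_elt c%:P.
Proof.
move=> [c0 uc pc]; split; rewrite ?polyC_eq0 ?polyC_unit // => f g dfg.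
have [df|/dvdr_polyCP/existsNP[i0 ni]] := pselect (dvdr c%:P f); first by left.
have [dg|/dvdr_polyCP/existsNP[j0 nj]] := pselect (dvdr c%:P g); first by right.
have exi : exists i, `[< ~ dvdr c f`_i >] by exists i0; apply/asboolP.
have exj : exists j, `[< ~ dvdr c g`_j >] by exists j0; apply/asboolP.
case: (ex_minnP exi) => i /asboolP{}ni mini {exi i0}.
case: (ex_minnP exj) => j /asboolP{}nj minj {exj j0}.
have dvf k : (k < i)%N -> dvdr c f`_k.
  by rewrite ltnNge => ki; apply: contrapT => /asboolP/mini; rewrite (negbTE ki).
have dvg k : (k < j)%N -> dvdr c g`_k.
  by rewrite ltnNge => kj; apply: contrapT => /asboolP/minj; rewrite (negbTE kj).
suff : dvdr c (f`_i * g`_j) by case/pc.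
have /dvdr_polyCP/(_ (i + j)%N) := dfg; rewrite coefM.
have lt : (i < (i + j).+1)%N by rewrite ltnS leq_addr.
rewrite (bigD1 (Ordinal lt)) //= addKn => d.
have d' : dvdr c (\sum_(k < (i + j).+1 | k != Ordinal lt) f`_k * g`_(i + j - k)).
  apply: (big_ind (dvdr c)) => [|_ _ [u ->] [v ->]|k ki].
  - by exists 0; rewrite mul0r.
  - by exists (u + v); rewrite mulrDl.
  have [lki|lik|eki] := ltngtP k i.
  - by apply/dvdr_mulr/dvf.
  - apply/dvdr_mull/dvg; rewrite ltn_subLR ?ltn_add2r //.
    by rewrite -ltnS ltn_ord.
  by case/eqP: ki; apply: val_inj.
move: d d' => [u eu] [v ev]; exists (u - v).
by rewrite mulrBl -eu -ev addrK.
Qed.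

Hypothesis fD : factorial_domain D.

(** Trivial content, expressed by primes so that no gcd of coefficients has to be defined. *)
Definition primitive f : Prop := forall c, prime_elt c -> ~ dvdr c%:P f.

Lemma primitive_dvdl f g : dvdr f g -> primitive g -> primitive f.
Proof. by move=> fg pg c pc cf; apply: (pg c pc); apply: dvdr_trans fg. Qed.

(** The prime factors of [c] stay prime in the polynomial ring and do not divide [f], so each of
    them can be cancelled against the cofactor. *)
Lemma primitive_cancel c f g : primitive f -> c != 0 -> dvdr f (c%:P * g) ->
  dvdr f g.
Proof.
move=> pf /fD[u [l [uu pl ->]]]; rewrite rmorphM rmorph_prod /= -mulrA.
move/dvdr_unit_mul; rewrite polyC_unit => /(_ uu).
elim: l pl => [|x l IHl] pl; first by rewrite big_nil mul1r.
have px := pl x (mem_head _ _); have [x0 _ _] := px.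
rewrite big_cons -mulrA => -[k e]; have [_ _ pxP] := polyC_prime px.
have [|[j ej]|xf] := pxP k f; last by case: (pf x px).
  by rewrite -e; apply/dvdr_mulr/dvdr_refl.
apply: IHl => [y yl|]; first by apply: pl; rewrite in_cons yl orbT.
exists j; apply: (@mulfI _ x%:P); rewrite ?polyC_eq0 // e ej.
by rewrite mulrAC mulrC.
Qed.

(** Induction on the number of prime factors of the leading coefficient: every prime constant pulled
    out of [f] uses up one of them. *)
Lemma exists_primitive_part f : f != 0 ->
  exists c g, [/\ c != 0, primitive g & f = c%:P * g].
Proof.
move=> f0; have [|u [l [uu pl e]]] := fD (a := lead_coef f).
  by rewrite lead_coef_eq0.
have [m lem] := ubnP (size l); elim: m l u uu f f0 pl e lem => // m IHm.
move=> l u uu f f0 pl e lem.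
have [pf|npf] := pselect (primitive f).
  by exists 1, f; rewrite oner_neq0 mul1r.
have [c [pc [g eg]]] : exists c, prime_elt c /\ dvdr c%:P f.
  by apply: contrapT => nc; apply: npf => c pc cf; apply: nc; exists c.
have [c0 uc dc] := pc.
have lg : lead_coef f = lead_coef g * c by rewrite eg lead_coefM lead_coefC.
have [x xl cx] : exists2 x, x \in l & dvdr c x.
  apply: prime_dvd_prod => //; apply: (dvdr_unit_mul uu).
  by rewrite -e lg; apply/dvdr_mull/dvdr_refl.
have [k ek] := cx; have uk : k \is a GRing.unit.
  by have [//|uc'] := prime_irreducible (pl x xl) ek; rewrite uc' in uc.
have g0 : g != 0 by apply: contraNneq f0 => g0; rewrite eg g0 mul0r.
have [||||d [h [d0 ph eh]]] := IHm (rem x l) (u * k) _ g g0.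
- by rewrite unitrM uu.
- by move=> y /mem_rem /pl.
- apply: (mulIf c0); rewrite -lg e (big_rem x xl) /= ek; ring.
- by rewrite size_rem // prednK; [rewrite -ltnS | case: (l) xl].
exists (d * c), h; rewrite mulf_neq0 // eg eh rmorphM /=; split=> //; ring.
Qed.

(** The relation [%|] is divisibility up to a nonzero constant, as over the fraction field; there
    [f] is prime by Gauss's gcd argument. Primitivity of [f] turns [%|] into true divisibility. *)
Lemma irredp_primitive_prime f : irreducible_poly f -> primitive f ->
  prime_elt f.
Proof.
move=> irf pf; have f0 := irredp_neq0 irf; case: (irf) => szf dvf.
have Cdvd g : f %| g -> dvdr f g.
  move=> /Pdiv.Idomain.dvdpP[[c k] /= c0 e]; apply: (primitive_cancel pf c0).
  by rewrite mul_polyC e; exists k.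
split=> // [|g h [k e]].
  by rewrite poly_unitE; apply: contraTN szf => /andP[/eqP->].
have [/eqP sz1|szg] := eqVneq (size (gcdp f g)) 1%N.
  right; apply: Cdvd; rewrite -(@Gauss_dvdpr _ h g) //.
  by rewrite e dvdp_mull.
left; apply: Cdvd; have := dvf _ szg (dvdp_gcdl f g).
by move=> /eqp_dvdl <-; apply: dvdp_gcdr.
Qed.

Lemma primitive_factor f : primitive f -> f != 0 ->
  exists u l, [/\ u \is a GRing.unit, {in l, forall x, prime_elt x} &
                  f = u * \prod_(x <- l) x].
Proof.
have [m] := ubnP (size f); elim: m f => // m IHm f le pf f0.
have [irf|nirf] := pselect (irreducible_poly f).
  exists 1, [:: f]; rewrite unitr1 big_seq1 mul1r; split=> // x.
  by rewrite inE => /eqP->; apply: irredp_primitive_prime.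
have [sz1|sz1] := leqP (size f) 1.
  exists f, [::]; rewrite big_nil mulr1; split=> //.
  (* A primitive constant has no prime factor, hence is a unit. *)
  have fc := size1_polyC sz1; have c0 : f`_0 != 0 by rewrite -polyC_eq0 -fc.
  have [u [[|x l] [uu pl e]]] := fD c0.
    by rewrite fc e big_nil mulr1 polyC_unit.
  case: (pf x); first by apply: pl; rewrite mem_head.
  rewrite fc e big_cons; apply: (dvdr_morph (@polyC D)).
  by apply/dvdr_mull/dvdr_mulr/dvdr_refl.
have [q [szq qf nqf]] : exists q : {poly D}, [/\ size q != 1%N, q %| f & ~~ (q %= f)].
  apply: contrapT => nq; apply: nirf; split=> // q szq qf.
  by apply: contrapT => /negP nqf; apply: nq; exists q.
have q0 : q != 0 by apply: dvdpN0 qf f0.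
have [c [g [c0 pg e]]] := exists_primitive_part q0.
(* [q] divides [f] only up to a constant, but its primitive part [g] divides [f] exactly. Both [g]
   and the cofactor are smaller than [f]. *)
have gf : dvdr g f.
  move: qf => /Pdiv.Idomain.dvdpP[[d k] /= d0 e'].
  apply: (primitive_cancel pg d0); rewrite mul_polyC e' e.
  by apply/dvdr_mull/dvdr_mull/dvdr_refl.
have szg : size g = size q by rewrite e size_Cmul.
have [k ek] := gf; have g0 : g != 0 by apply: contraNneq q0 => g0; rewrite e g0 mulr0.
have k0 : k != 0 by apply: contraNneq f0 => k0; rewrite ek k0 mul0r.
have ltg : (size g < size f)%N.
  rewrite ltn_neqAle szg dvdp_size_eqp // nqf dvdp_leq //.
have g1 : (1 < size g)%N.
  by rewrite szg ltn_neqAle eq_sym szq lt0n size_poly_eq0.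
have ltk : (size k < size f)%N.
  rewrite ek size_mul // -subn1 -addnBA; last by rewrite ltnW.
  by rewrite -[X in (X < _)%N]addn0 ltn_add2l subn_gt0.
have [|u [l [uu pl el]]] := IHm g (leq_trans ltg le) _ g0 => //.
have [|v [t [uv pt et]]] := IHm k (leq_trans ltk le) _ k0.
  by apply: primitive_dvdl pf; rewrite ek; apply/dvdr_mulr/dvdr_refl.
exists (v * u), (t ++ l); split; first by rewrite unitrM uv uu.
  by move=> x; rewrite mem_cat => /orP[/pt|/pl].
by rewrite big_cat /= mulrACA -et -el.
Qed.

Lemma poly_factorial : factorial_domain {poly D}.
Proof.
move=> f f0; have [c [g [c0 pg e]]] := exists_primitive_part f0.
have g0 : g != 0 by apply: contraNneq f0 => g0; rewrite e g0 mulr0.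
have [u [l [uu pl ec]]] := fD c0; have [v [t [uv pt eg]]] := primitive_factor pg g0.
exists (u%:P * v), (map polyC l ++ t); split.
- by rewrite unitrM polyC_unit uu uv.
- move=> x; rewrite mem_cat => /orP[/mapP[y yl ->]|/pt //].
  by apply: polyC_prime; apply: pl.
by rewrite big_cat /= big_map mulrACA -eg -rmorph_prod -rmorphM -ec.
Qed.

End PolyFactorial.

(** * Zeros of multivariate polynomials *)

Lemma eq_mpoly_additive n (R : nzRingType) (V : zmodType)
    (f g : {additive {mpoly R[n]} -> V}) :
  (forall c m, f (c *: 'X_[m]) = g (c *: 'X_[m])) -> f =1 g.
Proof.
by move=> fg p; rewrite [p]mpolyE !raddf_sum; apply: eq_bigr => m _; apply: fg.
Qed.

Section Uni.
Variables (n : nat) (K : fieldType).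
Implicit Types (p q : {mpoly K[n.+1]}) (P : {poly {mpoly K[n]}}).

(** The inverse of [muni]: coefficients are read in one more variable, and the polynomial variable
    becomes the last one. *)
Definition of_uni : {poly {mpoly K[n]}} -> {mpoly K[n.+1]} :=
  horner_eval 'X_ord_max \o map_poly (@mwiden n K).
HB.instance Definition _ := GRing.RMorphism.on of_uni.

Lemma muniX (m : 'X_{1..n.+1}) : muni ('X_[m] : {mpoly K[n.+1]}) =
  'X_[[multinom m (widen_ord (leqnSn n) i) | i < n]] *: 'X^(m ord_max).
Proof. by rewrite muniE msuppX big_seq1 mcoeffX eqxx scale1r. Qed.

Lemma of_uniK : cancel of_uni (@muni n K).
Proof.
move=> P; elim/poly_ind: P => [|P c IH]; first by rewrite !rmorph0.
rewrite !rmorphD !rmorphM /= IH; congr (_ * _ + _).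
  rewrite /of_uni /= map_polyX /horner_eval hornerX muniX mnm1E eqxx expr1.
  rewrite (_ : [multinom _ | _ < n] = 0%MM) ?mpolyX0 ?scale1r //.
  apply/mnmP => i; rewrite mnmE mnm1E mnm0E; apply/eqP; rewrite eqb0 -val_eqE /=.
  by rewrite gtn_eqF.
rewrite /of_uni /= map_polyC /= /horner_eval hornerC.
apply: (@eq_mpoly_additive _ _ _ (@muni n K \o @mwiden n K) polyC) => {}c m /=.
rewrite mwidenZ mwidenX muniZ muniX mnmwiden_ordmax expr0.
rewrite (_ : [multinom _ | _ < n] = m) ?alg_polyC -?mul_polyC -?rmorphM ?mul_mpolyC //.
by apply/mnmP => i; rewrite mnmE mnmwiden_widen.
Qed.

Lemma muniK : cancel (@muni n K) of_uni.
Proof.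
apply: (@eq_mpoly_additive _ _ _ (of_uni \o @muni n K) idfun) => c m /=.
rewrite muniZ -mul_polyC rmorphM muniX -mul_polyC rmorphM /=.
have ofC d : of_uni d%:P = mwiden d.
  by rewrite /of_uni /= map_polyC /= /horner_eval hornerC.
have ofX k : of_uni 'X^k = 'X_ord_max ^+ k.
  by rewrite rmorphXn /= /of_uni /= map_polyX /horner_eval hornerX.
rewrite !ofC ofX mwidenC mul_mpolyC mwidenX mpolyXn -mpolyXD; congr (_ *: 'X_[_]).
apply/mnmP => i; rewrite mnmDE mulmnE mnm1E.
case: (unliftP ord_max i) => [j ->|->]; last first.
  by rewrite mnmwiden_ordmax eqxx mul1n.
have -> : lift ord_max j = widen_ord (leqnSn n) j by apply/val_inj/lift_max.
rewrite mnmwiden_widen mnmE -val_eqE /= gtn_eqF //.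
by rewrite mul0n addn0.
Qed.

Lemma meval_muni p (v : 'I_n.+1 -> K) : p.@[v] =
  (map_poly (meval (v \o widen_ord (leqnSn n))) (muni p)).[v ord_max].
Proof.
pose w := v \o widen_ord (leqnSn n).
apply: (@eq_mpoly_additive _ _ _ (meval v)
  (horner_eval (v ord_max) \o map_poly (meval w) \o @muni n K)) => c m /=.
rewrite /horner_eval.
rewrite mevalZ mevalX muniZ muniX -mul_polyC -mul_polyC !rmorphM /= !map_polyC /=.
rewrite map_polyXn mevalC mevalX !hornerE -[RHS]mulrA; congr (_ * _).
rewrite big_ord_recr /=; congr (_ * _).
by apply: eq_bigr => i _; rewrite mnmE.
Qed.

End Uni.

Lemma mpoly_factorial (K : fieldType) n : factorial_domain {mpoly K[n]}.
Proof.
elim: n => [|n IHn].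
  move=> a a0; exists a, [::]; rewrite big_nil mulr1; split=> //.
  have ea := mpolyKC a; rewrite -ea; apply: (rmorph_unit (@mpolyC 0 K)).
  by rewrite unitfE; apply: contraNneq a0 => e; rewrite -ea e mpolyC0.
exact: iso_factorial (@of_uniK n K) (@muniK n K) (poly_factorial IHn).
Qed.

(** * From vanishing to divisibility over an algebraically closed field *)

Section Nullstellensatz.
Variable K : numClosedFieldType.

Lemma poly_eq0_fun (p : {poly K}) : (forall x, p.[x] = 0) -> p = 0.
Proof.
move=> p0; apply/eqP; apply: contraT => pn0.
(* In characteristic zero the first [size p] natural numbers are distinct roots, one more than the
   degree allows. *)
have := @max_poly_roots _ p [seq i%:R | i <- iota 0 (size p)] pn0.
rewrite size_map size_iota ltnn; apply.
  by apply/allP => x _; apply/eqP.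
by rewrite map_inj_uniq ?iota_uniq // => i j /eqP; rewrite eqr_nat => /eqP.
Qed.

Definition extend n (w : 'I_n -> K) (t : K) (i : 'I_n.+1) : K :=
  oapp w t (unlift ord_max i).

Lemma meval_extend n (p : {mpoly K[n.+1]}) w t :
  p.@[extend w t] = (map_poly (meval w) (muni p)).[t].
Proof.
rewrite meval_muni {2}/extend unlift_none /=; congr (_.[t]).
apply: eq_map_poly => c; apply: meval_eq => i /=.
have -> : widen_ord (leqnSn n) i = lift ord_max i by apply/val_inj/esym/lift_max.
by rewrite /extend liftK.
Qed.

(** Choose [w] where the leading coefficient in the last variable survives; the polynomial left in
    that variable is nonzero, so it cannot vanish everywhere. *)
Lemma exists_meval_neq0 n (p : {mpoly K[n]}) : p != 0 -> exists v, p.@[v] != 0.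
Proof.
elim: n p => [|n IHn] p p0.
  exists (fun=> 0); rewrite -[p]mpolyKC mevalC.
  by apply: contraNneq p0 => e; rewrite -[p]mpolyKC e.
have P0 : lead_coef (muni p) != 0.
  by rewrite lead_coef_eq0 -(rmorph0 (@muni n K)) (can_eq (@muniK n K)).
have [w w0] := IHn _ P0; apply: contrapT => ne; case/eqP: w0.
rewrite lead_coefE -coef_map (poly_eq0_fun (p := map_poly _ _)) ?coef0 // => t.
by rewrite -meval_extend; apply: contrapT => /eqP h; apply: ne; exists (extend w t).
Qed.

Lemma prime_dvd_zeros n (p q : {mpoly K[n]}) : prime_elt p ->
  (forall v, p.@[v] = 0 -> q.@[v] = 0) -> dvdr p q.
Proof.
elim: n p q => [|n IHn] p q pp pq.
  have [p0 up _] := pp; apply: dvdr_unitl; move: up p0.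
  rewrite -[p]mpolyKC [_%:MP == 0]mpolyC_eq0 => up p0; case/negP: up.
  by apply: (rmorph_unit (@mpolyC 0 K)); rewrite unitfE.
suff [k e] : dvdr (muni p) (muni q).
  exists (of_uni k); apply: (can_inj (@muniK n K)).
  by rewrite e muniM of_uniK.
have {}pp : prime_elt (muni p) := iso_prime (@muniK n K) (@of_uniK n K) pp.
have {}pq w t : (map_poly (meval w) (muni p)).[t] = 0 ->
    (map_poly (meval w) (muni q)).[t] = 0.
  by have := pq (extend w t); rewrite (meval_extend p) (meval_extend q).
move: (muni p) (muni q) pp pq => {p q} P Q PP PQ.
have [P0 uP primeP] := PP.
(* If the last variable does not occur in [P], then above a zero of [P] all values of that variable
   are zeros of [Q]; so each coefficient of [Q] vanishes there and the induction hypothesis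
   applies. *)
have [sz1|sz1] := leqP (size P) 1.
  have eP := size1_polyC sz1; rewrite eP in PP PQ *; set c := P`_0 in PP PQ *.
  have pc : prime_elt c.
    have [c0 uc pc] := PP; rewrite polyC_eq0 polyC_unit in c0 uc.
    split=> // a b /(dvdr_morph (@polyC _)) /=; rewrite polyCM => /pc.
    by case=> /dvdr_polyCP/(_ 0%N); rewrite coefC; [left|right].
  apply/dvdr_polyCP => i; apply: IHn => // w cw.
  rewrite -coef_map (poly_eq0_fun (p := map_poly _ _)) ?coef0 // => t.
  by apply: PQ; rewrite map_polyC /= hornerC.
(* Up to a constant, [P] is [k] times the gcd. If [P] divides [k], the gcd divides a constant; if
   [P] divides the gcd, it divides a constant multiple of [Q], which is impossible. *)
apply: contrapT => nPQ; have cop : coprimep P Q.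
  have /Pdiv.Idomain.dvdpP[[c k] /= c0 e] := dvdp_gcdl P Q.
  have g0 : gcdp P Q != 0 by rewrite gcdp_eq0 negb_and P0.
  have [|[j ej]|Pg] := primeP k (gcdp P Q).
  - by rewrite -e -mul_polyC; apply/dvdr_mull/dvdr_refl.
  - have /eqP : c%:P * P = (j * gcdp P Q) * P by rewrite mul_polyC e ej; ring.
    rewrite (inj_eq (mulIf P0)) => /eqP ec.
    have dv1 : gcdp P Q %| c%:P by rewrite ec dvdp_mull.
    rewrite coprimep_def eqn_leq (leq_trans (dvdp_leq _ dv1)) ?polyC_eq0 //.
      by rewrite lt0n size_poly_eq0.
    exact: size_polyC_leq1.
  have [j ej] := Pg; have /Pdiv.Idomain.dvdpP[[d l] /= d0 el] := dvdp_gcdr P Q.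
  have [|Pd|//] := primeP d%:P Q.
    by rewrite mul_polyC el ej; apply/dvdr_mull/dvdr_mull/dvdr_refl.
  have [i ei] := Pd; have Pd' : P %| d%:P by rewrite ei dvdp_mull.
  have := dvdp_leq _ Pd'; rewrite polyC_eq0 => /(_ d0).
  by rewrite leqNgt size_polyC d0 sz1.
have /Bezout_coprimepP[[u v] /=] := cop.
rewrite -size_poly_eq1 => /size_poly1P[m m0 em].
(* Keeping the leading coefficient nonzero at [w] preserves the degree of [P], so [P] has a root [t]
   above [w]; there the Bezout relation forces [m] to vanish. *)
have [w] : exists w, (m * lead_coef P).@[w] != 0.
  by apply: exists_meval_neq0; rewrite mulf_neq0 // lead_coef_eq0.
rewrite mevalM mulf_eq0 negb_or => /andP[mw lw].
have [t /eqP Pt] : exists t, root (map_poly (meval w) P) t.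
  apply/closed_rootP; rewrite size_map_poly_id0 //.
  by rewrite neq_ltn sz1 orbT.
have /(congr1 (fun p => (map_poly (meval w) p).[t])) := em.
rewrite rmorphD !rmorphM /= !hornerE map_polyC /= hornerC (PQ _ _ Pt) Pt !mulr0.
by rewrite addr0 => /eqP; rewrite eq_sym (negbTE mw).
Qed.

End Nullstellensatz.

(** * Scaling, homogeneity and substitutions *)

Section Scaled.
Variables (K : fieldType) (n : nat).
Implicit Types (p q f g : {mpoly K[n]}) (m : 'X_{1..n}).

Lemma mpoly_unitP p :
  p \is a GRing.unit -> exists2 c : K, c != 0 & p = c%:MP.
Proof.
rewrite unfold_in => /andP[/eqP ep]; rewrite unitfE => c0.
by exists p@_0.
Qed.

Lemma mpolyC_unit (c : K) : c != 0 -> (c%:MP : {mpoly K[n]}) \is a GRing.unit.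
Proof. by move=> c0; apply: (rmorph_unit (@mpolyC n K)); rewrite unitfE. Qed.

Lemma scaled_refl p : scaled p p.
Proof. by exists 1; rewrite ?oner_neq0 ?scale1r. Qed.

Lemma scaled_sym p q : scaled p q -> scaled q p.
Proof.
move=> [c c0 ->]; exists c^-1; first by rewrite invr_neq0.
by rewrite scalerA mulVf ?scale1r.
Qed.

Lemma scaled_trans q p f : scaled p q -> scaled q f -> scaled p f.
Proof.
move=> [c c0 ->] [d d0 ->]; exists (c * d); first by rewrite mulf_neq0.
by rewrite scalerA.
Qed.

Lemma scaled_exp k p q : scaled p q -> scaled (p ^+ k) (q ^+ k).
Proof.
by move=> [c c0 ->]; exists (c ^+ k); rewrite ?expf_neq0 // exprZn.
Qed.

Lemma scaled_dvdr p q : scaled p q -> dvdr p q.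
Proof.
by move=> /scaled_sym[c _ ->]; exists c%:MP; rewrite mul_mpolyC.
Qed.

Lemma dvdr_scaled p q : dvdr p q -> dvdr q p -> scaled p q.
Proof.
move=> [k ek] [j ej]; have [q0|q0] := eqVneq q 0.
  by rewrite ej q0 mulr0; apply: scaled_refl.
have uj : j \is a GRing.unit.
  apply/unitrP; exists k; suff e : j * k = 1 by rewrite mulrC e.
  by apply: (mulIf q0); rewrite mul1r {2}ek ej; ring.
have [c c0 ec] := mpoly_unitP uj.
by exists c; rewrite // ej ec mul_mpolyC.
Qed.

Lemma prime_dvd_scaled p q : prime_elt p -> prime_elt q -> dvdr p q -> scaled p q.
Proof.
move=> [_ up _] pq d; apply: dvdr_scaled => //; exact: prime_dvd_sym.
Qed.

Lemma scaled_prime p q : scaled p q -> prime_elt q -> prime_elt p.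
Proof.
move=> spq [q0 uq pq]; have pq' := scaled_dvdr spq.
have qp' := scaled_dvdr (scaled_sym spq); split=> [||a b /(dvdr_trans qp')/pq].
- by case: spq => c c0 ->; rewrite scaler_eq0 negb_or c0.
- by apply: contra uq => up; apply: dvdr_unit qp'.
- by case=> h; [left | right]; apply: dvdr_trans h.
Qed.

Lemma mirreducible_prime p : mirreducible p <-> prime_elt p.
Proof.
split=> [[p0 up ip]|pp]; first exact: (irreducible_prime (@mpoly_factorial K n)).
have [p0 up _] := pp; split=> //; exact: prime_irreducible.
Qed.

Lemma dhomog_scaled d p q : scaled p q -> q \is d.-homog -> p \is d.-homog.
Proof. by move=> [c _ ->]; apply: dhomogZ. Qed.

Lemma dhomog0_unit p : p != 0 -> p \is 0.-homog -> p \is a GRing.unit.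
Proof.
move=> p0 hp; have ep : p = (p@_0)%:MP.
  apply/mpolyP => m; rewrite mcoeffC; have [->|m0] := eqVneq m 0%MM.
    by rewrite mulr1.
  by rewrite mulr0 (dhomog_nemf_coeff hp) // mdeg_eq0.
by rewrite ep mpolyC_unit // -(mpolyC_eq0 n) -ep.
Qed.

(** Multiplies each variable by a new variable [T], whose exponent then records the degree. *)
Definition degree_split : {mpoly K[n]} -> {poly {mpoly K[n]}} :=
  mmap (polyC \o @mpolyC n K) (fun i => ('X_i)%:P * 'X).
HB.instance Definition _ := GRing.RMorphism.on degree_split.

Lemma coef_degree_split p k : (degree_split p)`_k = pihomog mdeg k p.
Proof.
apply: (@eq_mpoly_additive _ _ _ (coefp k \o degree_split)
  (pihomog mdeg k)) => c m /=.
rewrite linearZ /= pihomogX /degree_split mmapZ mmapX /mmap1 /=.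
under eq_bigr do rewrite exprMn.
rewrite big_split /= prodrXr -mdegE.
under eq_bigr do rewrite -rmorphXn.
rewrite -rmorph_prod -mpolyXE_id mulrA -polyCM coefCM coefXn mul_mpolyC.
by rewrite eq_sym; case: eqP; rewrite ?mulr1 ?mulr0 ?scaler0.
Qed.

(** The image of [q] under [degree_split] is [q] times a power of [T]. Once the powers of [T] are
    taken out of the images of both factors, the remaining parts have a product constant in [T], so
    each is constant. *)
Lemma dhomog_dvd d p q : q != 0 -> q \is d.-homog -> dvdr p q ->
  exists e, p \is e.-homog.
Proof.
move=> q0 hq [k eq_q].
have split_neq0 (f : {mpoly K[n]}) : f != 0 -> degree_split f != 0.
  move=> f0; apply: contraNneq f0 => ef.
  rewrite (pihomog_partitionE (leqnn (mmeasure mdeg f))).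
  by rewrite big1 // => i _; rewrite -coef_degree_split ef coef0.
have [k0 p0] : k != 0 /\ p != 0.
  by apply/andP; rewrite -negb_or -mulf_eq0 -eq_q.
have eA : degree_split q = q *: 'X^d.
  apply/polyP => i; rewrite coef_degree_split coefZ coefXn.
  have [->|ni] := eqVneq i d; first by rewrite mulr1 pihomog_dE.
  by rewrite mulr0 (pihomog_ne0 _ hq) // eq_sym.
have [i [A nA EA]] := multiplicity_XsubC (degree_split p) 0.
have [j [B nB EB]] := multiplicity_XsubC (degree_split k) 0.
rewrite split_neq0 //= polyC0 subr0 in nA EA.
rewrite split_neq0 //= polyC0 subr0 in nB EB.
have A0 : A`_0 != 0 by rewrite -horner_coef0.
have B0 : B`_0 != 0 by rewrite -horner_coef0.
have {}eA : (B * A) * 'X^(i + j) = q *: 'X^d.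
  by rewrite -eA eq_q rmorphM /= EA EB exprD; ring.
(* The coefficient at [i + j] is the product of the nonzero constant terms of [A] and [B]. *)
have ed : (i + j)%N = d.
  apply/eqP; have /polyP/(_ (i + j)%N) := eA.
  rewrite coefMXn ltnn subnn coefM big_ord1 coefZ coefXn => e.
  have := mulf_neq0 B0 A0; rewrite e; case: (_ =P d) => // _.
  by rewrite mulr0 eqxx.
have : B * A = q%:P.
  by apply: (@mulIf _ 'X^d); rewrite ?monic_neq0 ?monicXn // mul_polyC -eA ed.
move=> /(congr1 (size \o polyseq))/eqP /=; rewrite size_polyC q0.
have nzA : A != 0 by apply: contraNneq A0 => ->; rewrite coef0.
have nzB : B != 0 by apply: contraNneq B0 => ->; rewrite coef0.
rewrite size_mul_eq1 => /andP[_ /size_poly1P[c c0 eqA]].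
exists i; rewrite (pihomog_partitionE (leqnn (mmeasure mdeg p))).
apply: rpred_sum => l _; have [->|nl] := eqVneq (l : nat) i; first exact: pihomogP.
rewrite -coef_degree_split EA eqA mul_polyC coefZ coefXn (negbTE nl) mulr0.
exact: dhomog0.
Qed.

(** Both factors of a variable are homogeneous and their degrees add up to 1, so one has degree
    0. *)
Lemma mpolyX_prime i : prime_elt ('X_i : {mpoly K[n]}).
Proof.
have X0 : 'X_i != 0 :> {mpoly K[n]} by rewrite -msize_poly_eq0 msizeX.
have hX : ('X_i : {mpoly K[n]}) \is 1.-homog.
  by rewrite dhomogX; apply/eqP; apply: mdeg1.
apply/mirreducible_prime; split=> // [|a b e].
  apply/negP => /mpoly_unitP[c c0 e]; have := congr1 (fun p => msize p) e.
  by rewrite msizeX mdeg1 msizeC c0.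
have [a0 b0] : a != 0 /\ b != 0 by apply/andP; rewrite -negb_or -mulf_eq0 -e.
have [|da ha] := dhomog_dvd (p := a) X0 hX.
  by exists b; rewrite e mulrC.
have [|db hb] := dhomog_dvd (p := b) X0 hX; first by exists a.
have := dhomog_uniq X0 hX; rewrite e => /(_ _ (dhomogM ha hb)).
case: da ha => [|da] ha; first by left; apply: dhomog0_unit.
case: db hb => [|db] hb; first by right; apply: dhomog0_unit.
by rewrite addSn addnS.
Qed.

Lemma dvdr_mpolyXP i p :
  dvdr 'X_i p <-> {in msupp p, forall m, (0 < m i)%N}.
Proof.
split=> [[k ->] m|h].
  rewrite (perm_mem (msuppMX _ _)) => /mapP[m' _ ->].
  by rewrite mnmDE mnm1E eqxx.
rewrite [p]mpolyE big_seq; apply: (big_ind (dvdr 'X_i)).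
- by exists 0; rewrite mul0r.
- by move=> _ _ [a ->] [b ->]; exists (a + b); rewrite mulrDl.
move=> m /h m0; exists (p@_m *: 'X_[m - U_(i)]).
rewrite -scalerAl -mpolyXD submK //; apply/mnm_lepP => j; rewrite mnm1E.
by case: eqP => [<-|].
Qed.

End Scaled.

(** * Substitution of powers and rescaling of the variables *)

Section Substitutions.
Variables (K : fieldType) (n : nat).
Implicit Types (p q f g : {mpoly K[n]}) (m : 'X_{1..n}) (a b : 'I_n -> K).

HB.instance Definition _ r := GRing.RMorphism.copy (@subst_pow K n r)
  (comp_mpoly [tuple 'X_i ^+ r | i < n]).
HB.instance Definition _ r := GRing.Linear.copy (@subst_pow K n r)
  (comp_mpoly [tuple 'X_i ^+ r | i < n]).
HB.instance Definition _ a := GRing.RMorphism.copy (@rescale K n a)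
  (comp_mpoly [tuple a i *: 'X_i | i < n]).
HB.instance Definition _ a := GRing.Linear.copy (@rescale K n a)
  (comp_mpoly [tuple a i *: 'X_i | i < n]).

Lemma subst_powX r m : subst_pow r 'X_[m] = 'X_[m *+ r] :> {mpoly K[n]}.
Proof.
rewrite /subst_pow comp_mpolyX mpolyXE_id; apply: eq_bigr => i _.
by rewrite tnth_mktuple -exprM mulmnE mulnC.
Qed.

Lemma mcoeff_subst_pow r f m : (0 < r)%N -> (subst_pow r f)@_(m *+ r) = f@_m.
Proof.
move=> r0; apply: (@eq_mpoly_additive _ _ _ (mcoeff (m *+ r) \o @subst_pow K n r)
  (mcoeff m)) => c k /=.
rewrite linearZ /= subst_powX !mcoeffZ !mcoeffX; congr (_ * (nat_of_bool _)%:R).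
apply/eqP/eqP => [/mnmP e|->//]; apply/mnmP => i; move: (e i).
by rewrite !mulmnE => /eqP; rewrite eqn_pmul2r // => /eqP.
Qed.

Lemma subst_pow_exists r f : (forall m i, m \in msupp f -> (r %| m i)%N) ->
  exists g, f = subst_pow r g.
Proof.
move=> rf; exists (\sum_(m <- msupp f) f@_m *: 'X_[[multinom (m i %/ r)%N | i < n]]).
rewrite raddf_sum {1}[f]mpolyE big_seq [RHS]big_seq; apply: eq_bigr => m mf /=.
rewrite linearZ /= subst_powX; congr (_ *: 'X_[_]).
by apply/mnmP => i; rewrite mulmnE mnmE divnK // rf.
Qed.

Lemma meval_subst_pow r f (v : 'I_n -> K) :
  (subst_pow r f).@[v] = f.@[fun i => v i ^+ r].
Proof.
rewrite comp_mpoly_meval; apply: meval_eq => i.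
by rewrite tnth_mktuple rmorphXn /= mevalXU.
Qed.

Lemma dhomog_subst_pow r d f : (0 < r)%N -> subst_pow r f \is d.-homog ->
  f \is (d %/ r).-homog.
Proof.
move=> r0 /dhomogP h; apply/dhomogP => m mf.
have <- : mdeg (m *+ r) = d.
  by apply: h; rewrite mcoeff_msupp mcoeff_subst_pow // -mcoeff_msupp.
by rewrite mdegMn mulnK.
Qed.

Lemma rescaleX a m : rescale a 'X_[m] = (\prod_i a i ^+ m i) *: 'X_[m].
Proof.
rewrite /rescale comp_mpolyX [X in _ *: X]mpolyXE_id -scaler_prod.
by apply: eq_bigr => i _; rewrite tnth_mktuple exprZn.
Qed.

Lemma mcoeff_rescale a f m : (rescale a f)@_m = (\prod_i a i ^+ m i) * f@_m.
Proof.
rewrite [X in _ * X@_m]mpolyE {1}[f]mpolyE.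
rewrite (raddf_sum (rescale a)) !(raddf_sum (mcoeff m)) mulr_sumr /=.
apply: eq_bigr => k _; rewrite linearZ /= rescaleX !mcoeffZ !mcoeffX.
by case: eqP => [->|]; rewrite ?mulr0 // !mulr1 mulrC.
Qed.

Lemma rescaleM a b f : rescale a (rescale b f) = rescale (fun i => a i * b i) f.
Proof.
apply/mpolyP => m; rewrite !mcoeff_rescale mulrA -big_split /=.
by congr (_ * _); apply: eq_bigr => i _; rewrite exprMn.
Qed.

Lemma rescale1 f : rescale (fun=> 1) f = f.
Proof.
apply/mpolyP => m; rewrite mcoeff_rescale big1 ?mul1r // => i _.
by rewrite expr1n.
Qed.

Lemma meval_rescale a f (v : 'I_n -> K) :
  (rescale a f).@[v] = f.@[fun i => a i * v i].
Proof.
rewrite comp_mpoly_meval; apply: meval_eq => i.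
by rewrite tnth_mktuple mevalZ mevalXU.
Qed.

Lemma dhomog_rescale d a f : f \is d.-homog -> rescale a f \is d.-homog.
Proof.
move=> /dhomogP h; apply/dhomogP => m; rewrite mcoeff_msupp mcoeff_rescale.
by rewrite mulf_eq0 negb_or => /andP[_]; rewrite -mcoeff_msupp; apply: h.
Qed.

Lemma scaled_rescale a f g : scaled f g -> scaled (rescale a f) (rescale a g).
Proof. by move=> [c c0 ->]; exists c; rewrite // linearZ. Qed.

Section RootVectors.
Variables (r : nat) (hr : (0 < r)%N).

Lemma root_vector1 : root_vector r (fun _ : 'I_n => 1 : K).
Proof. by move=> i; rewrite expr1n. Qed.

Lemma root_vectorM a b : root_vector r a -> root_vector r b ->
  root_vector r (fun i => a i * b i).
Proof. by move=> ra rb i; rewrite exprMn ra rb mulr1. Qed.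

Lemma root_vectorV a : root_vector r a -> root_vector r (fun i => (a i)^-1).
Proof. by move=> ra i; rewrite exprVn ra invr1. Qed.

Lemma root_vector_neq0 a i : root_vector r a -> a i != 0.
Proof.
move=> /(_ i); apply: contra_eq_neq => ->.
by rewrite expr0n eqn0Ngt hr eq_sym oner_neq0.
Qed.

Lemma rescaleK a : root_vector r a ->
  cancel (rescale a) (rescale (fun i => (a i)^-1)).
Proof.
move=> ra f; rewrite rescaleM -[RHS]rescale1; congr rescale; apply: funext => i.
by rewrite mulVf // root_vector_neq0.
Qed.

Lemma rescaleVK a : root_vector r a ->
  cancel (rescale (fun i => (a i)^-1)) (rescale a).
Proof.
move=> ra f; rewrite rescaleM -[RHS]rescale1; congr rescale; apply: funext => i.
by rewrite mulfV // root_vector_neq0.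
Qed.

Lemma rescale_prime a f : root_vector r a -> prime_elt f -> prime_elt (rescale a f).
Proof. by move=> ra; apply: (iso_prime (rescaleK ra) (rescaleVK ra)). Qed.

Lemma scaled_rescale_variable a f : root_vector r a ->
  (exists i, scaled f 'X_i) -> exists i, scaled (rescale a f) 'X_i.
Proof.
move=> ra [i /(scaled_rescale a) h]; exists i; apply: scaled_trans h _.
rewrite rescaleX; exists (\prod_j a j ^+ U_(i)%MM j) => //.
by apply/prodf_neq0 => j _; rewrite expf_neq0 // root_vector_neq0.
Qed.

End RootVectors.
End Substitutions.

(** * The polynomial s_r(f) *)

(** In characteristic zero ['X^r - 1] is separable, so it has [r] distinct roots, and [r] distinct
    roots of unity include a primitive one. *)
Lemma prim_root_exists (K : numClosedFieldType) r : (0 < r)%N ->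
  exists z : K, r.-primitive_root z.
Proof.
move=> r0; have [rs Dp] := closed_field_poly_normal ('X^r - 1 : {poly K}).
rewrite (monicP _) ?monicXnsubC // scale1r in Dp.
have rn1 : all r.-unity_root rs by apply/allP => z; rewrite -root_prod_XsubC -Dp.
have sz_r : (r < (size rs).+1)%N.
  by rewrite -(size_prod_XsubC rs id) -Dp size_XnsubC.
have [|z _ hz] := hasP (has_prim_root r0 rn1 _ sz_r); last by exists z.
by rewrite -separable_prod_XsubC -Dp separable_Xn_sub_1 // pnatr_eq0 -lt0n.
Qed.

Section Orbits.
Variables (K : numClosedFieldType) (n r : nat) (hr : (0 < r)%N).
Implicit Types (f g x : {mpoly K[n]}) (a : 'I_n -> K).

Lemma rescalings_finite f : exists l : seq {mpoly K[n]}, forall g,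
  g \in l <-> exists2 a, root_vector r a & g = rescale a f.
Proof.
have [z pz] := prim_root_exists K hr.
(* Root vectors are the vectors of powers of [z] with exponents below [r], so there are finitely
   many. *)
exists (codom (fun phi : {ffun 'I_n -> 'I_r} => rescale (fun i => z ^+ phi i) f)).
move=> g; split=> [/codomP[phi ->]|[a ra ->]].
  exists (fun i => z ^+ phi i) => // i.
  by rewrite exprAC (prim_expr_order pz) expr1n.
have /boolp.choice[phi ephi] i : exists k : 'I_r, a i = z ^+ k.
  by have [k ek] := prim_rootP pz (ra i); exists k.
apply/codomP; exists (finfun phi); congr rescale; apply: funext => i.
by rewrite ffunE.
Qed.

Lemma scaled_reps_exist (l : seq {mpoly K[n]}) : exists l',
  [/\ uniq l', {subset l' <= l}, {in l' &, forall g h, scaled g h -> g = h} &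
      {in l, forall g, exists2 h, h \in l' & scaled h g}].
Proof.
elim: l => [|x l [l' [ul sl il rl]]]; first by exists [::].
have sl' : {subset l' <= x :: l} by move=> y /sl yl; rewrite in_cons yl orbT.
have [[h hl hx]|nx] := pselect (exists2 h, h \in l' & scaled h x).
  exists l'; split=> // y; rewrite in_cons => /predU1P[->|/rl //].
  by exists h.
exists (x :: l'); split=> /= [||g h|y].
- by rewrite ul andbT; apply: contra_notN nx => xl; exists x => //; apply: scaled_refl.
- by move=> y; rewrite in_cons => /predU1P[->|/sl' //]; rewrite mem_head.
- rewrite !in_cons => /predU1P[->|gl] /predU1P[->|hl] // s; last exact: il.
    by case: nx; exists h => //; apply: scaled_sym.
  by case: nx; exists g.
rewrite in_cons => /predU1P[->|/rl[h hl hy]].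
  by exists x; [rewrite mem_head | apply: scaled_refl].
by exists h; rewrite // in_cons hl orbT.
Qed.

(** One list for the union of all orbits: an orbit shared by several factors enters once, as it does
    in the least common multiple. *)
Definition orbit_reps m (f_ : 'I_m -> {mpoly K[n]}) (L : seq {mpoly K[n]}) : Prop :=
  [/\ uniq L, {in L &, forall g h, scaled g h -> g = h},
      {in L, forall g, exists i, exists2 a, root_vector r a & g = rescale a (f_ i)} &
      forall i a, root_vector r a -> exists2 g, g \in L & scaled g (rescale a (f_ i))].

Lemma orbit_reps_exist m (f_ : 'I_m -> {mpoly K[n]}) : exists L, orbit_reps f_ L.
Proof.
have /boolp.choice[l_ hl] i := rescalings_finite (f_ i).
have [L [uL sL iL rL]] := scaled_reps_exist (flatten [seq l_ i | i <- enum 'I_m]).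
exists L; split=> // [g /sL /flattenP[l /mapP[i _ ->] /hl]|i a ra]; first by exists i.
apply: rL; apply/flattenP; exists (l_ i); last by apply/hl; exists a.
by apply/mapP; exists i; rewrite ?mem_enum.
Qed.

Lemma orbit_list_exists f : exists l, orbit_list r f l.
Proof.
have [l [ul il dl rl]] := orbit_reps_exist (fun _ : 'I_1 => f).
exists l; split=> // [g /dl[_]|a ra]; [exact | exact: (rl ord0)].
Qed.

Lemma is_sr_irr_exists f : exists s, is_sr_irr r f s.
Proof.
have [[i fi]|nf] := pselect (exists i, scaled f 'X_i).
  by exists ('X_i ^+ r); apply: (SrVariable fi); apply: scaled_refl.
have [l ol] := orbit_list_exists f.
exists (\prod_(g <- l) g); apply: (SrOrbit _ ol); last exact: scaled_refl.
by move=> i fi; apply: nf; exists i.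
Qed.

Definition sr_mult x : nat := if `[< exists i, scaled x 'X_i >] then r else 1%N.

Lemma sr_mult_variable x i : scaled x 'X_i -> sr_mult x = r.
Proof. by move=> h; rewrite /sr_mult asboolT //; exists i. Qed.

Lemma sr_mult_nonvariable x : (forall i, ~ scaled x 'X_i) -> sr_mult x = 1%N.
Proof. by move=> h; rewrite /sr_mult asboolF // => -[i /h]. Qed.

Lemma sr_mult_gt0 x : (0 < sr_mult x)%N.
Proof. by rewrite /sr_mult; case: ifP. Qed.

Lemma sr_mult_le x : (sr_mult x <= r)%N.
Proof. by rewrite /sr_mult; case: ifP. Qed.

Lemma sr_mult_gt1 x : (1 < sr_mult x)%N -> exists i, scaled x 'X_i.
Proof. by rewrite /sr_mult; case: asboolP. Qed.

Lemma sr_mult_scaled x g : scaled x g -> sr_mult x = sr_mult g.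
Proof.
move=> xg; rewrite /sr_mult; congr (if _ then _ else _); apply: asbool_equiv_eq.
by split=> -[i h]; exists i; apply: scaled_trans h; rewrite //; apply: scaled_sym.
Qed.

Lemma sr_mult_rescale a x : root_vector r a -> sr_mult (rescale a x) = sr_mult x.
Proof.
move=> ra; rewrite /sr_mult; congr (if _ then _ else _); apply: asbool_equiv_eq.
split=> h; last exact: (scaled_rescale_variable hr ra).
rewrite -(rescaleK hr ra x).
exact: (scaled_rescale_variable hr (root_vectorV ra)).
Qed.

Lemma subst_pow_inj : injective (@subst_pow K n r).
Proof.
move=> f g e; apply/mpolyP => k.
by rewrite -(mcoeff_subst_pow f k hr) e mcoeff_subst_pow.
Qed.

Lemma subst_pow_unit f : subst_pow r f \is a GRing.unit -> f \is a GRing.unit.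
Proof.
move=> /mpoly_unitP[c c0 e]; rewrite (_ : f = c%:MP) ?mpolyC_unit //.
by apply: subst_pow_inj; rewrite e /subst_pow comp_mpolyC.
Qed.

(** * The product of the orbit representatives of a family of primes *)

Section Family.
Variables (m : nat) (f_ : 'I_m -> {mpoly K[n]}) (L : seq {mpoly K[n]}).
Hypotheses (pf : forall i, prime_elt (f_ i)) (oL : orbit_reps f_ L).

Definition sr_prod := \prod_(x <- L) x ^+ sr_mult x.

Lemma reps_prime : {in L, forall x, prime_elt x}.
Proof. by case: oL => _ _ dL _ x /dL[i [a ra ->]]; apply: (rescale_prime hr). Qed.

Lemma reps_nonassoc : nonassoc L.
Proof.
case: oL => _ iL _ _ x y xL yL d; apply: iL => //.
by apply: prime_dvd_scaled d; apply: reps_prime.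
Qed.

Lemma reps_uniq : uniq L. Proof. by case: oL. Qed.

Lemma sr_prod_neq0 : sr_prod != 0.
Proof.
rewrite /sr_prod prodf_seq_neq0; apply/allP => x xL /=; rewrite expf_neq0 //.
by have [] := reps_prime xL.
Qed.

Lemma reps_dvd_sr_prod x : x \in L -> dvdr (x ^+ sr_mult x) sr_prod.
Proof. exact: dvdr_prod_mem. Qed.

Lemma orbit_dvd_sr_prod i a : root_vector r a ->
  dvdr (rescale a (f_ i) ^+ sr_mult (f_ i)) sr_prod.
Proof.
move=> ra; have [_ _ _ /(_ i a ra)[x xL xs]] := oL.
apply: dvdr_trans (reps_dvd_sr_prod xL).
rewrite (sr_mult_scaled xs) (sr_mult_rescale _ ra).
by apply: dvdr_exp; apply: scaled_dvdr; apply: scaled_sym.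
Qed.

Lemma prime_exp_dvd_sr_prod p k : prime_elt p -> (0 < k)%N ->
  dvdr (p ^+ k) sr_prod -> exists x, [/\ x \in L, scaled x p & (k <= sr_mult x)%N].
Proof.
move=> pp k0 d; have [x [xL px lk]] := prime_exp_dvd_prod reps_uniq reps_prime
  reps_nonassoc pp k0 d.
exists x; split=> //; apply: scaled_sym.
by apply: prime_dvd_scaled px => //; apply: reps_prime.
Qed.

Lemma sr_prod_dvd g :
  (forall i a, root_vector r a -> dvdr (rescale a (f_ i) ^+ sr_mult (f_ i)) g) ->
  dvdr sr_prod g.
Proof.
move=> d; apply: (prod_prime_exp_dvd reps_uniq reps_prime reps_nonassoc) => x xL.
case: oL => _ _ /(_ x xL)[i [a ra ->]] _.
by rewrite sr_mult_rescale //; apply: d.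
Qed.

(** Each [s_ i] is up to scaling a product of powers of non-associated primes, all dividing
    [sr_prod]. Conversely a multiple of every [s_ i] is divisible by all the prime powers that make
    up [sr_prod]. *)
Lemma is_lcm_sr_prod (s_ : 'I_m -> {mpoly K[n]}) :
  (forall i, is_sr_irr r (f_ i) (s_ i)) -> is_lcm s_ sr_prod.
Proof.
move=> hs; split=> [i|t ht].
  case: (hs i) => [k fk sk|l nf [ul il dl rl] sl].
    apply: dvdr_trans (scaled_dvdr sk) _.
    have := orbit_dvd_sr_prod i (@root_vector1 K n r).
    rewrite rescale1 (sr_mult_variable fk); apply: dvdr_trans.
    by apply: scaled_dvdr; apply/scaled_exp/scaled_sym.
  apply: dvdr_trans (scaled_dvdr sl) _.
  have pl : {in l, forall g, prime_elt g}.
    by move=> g /dl[a ra ->]; apply: (rescale_prime hr).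
  apply: (@prod_prime_exp_dvd _ l (fun=> 1%N)) => //.
    by move=> g h gl hl gh; apply: il => //; apply: prime_dvd_scaled gh; apply: pl.
  move=> g /dl[a ra ->]; have := orbit_dvd_sr_prod i ra.
  by rewrite (sr_mult_nonvariable nf).
apply: sr_prod_dvd => i a ra; apply: dvdr_trans (ht i).
case: (hs i) => [k fk sk|l nf [ul il dl rl] sl].
  apply: dvdr_trans (scaled_dvdr (scaled_sym sk)); rewrite (sr_mult_variable fk).
  apply: dvdr_exp; apply: scaled_dvdr.
  apply: scaled_trans (scaled_rescale a fk) _; rewrite rescaleX.
  exists (\prod_j a j ^+ U_(k)%MM j) => //.
  by apply/prodf_neq0 => j _; rewrite expf_neq0 // (root_vector_neq0 hr).
apply: dvdr_trans (scaled_dvdr (scaled_sym sl)).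
rewrite (sr_mult_nonvariable nf) expr1; have [g gl gs] := rl a ra.
apply: dvdr_trans (scaled_dvdr (scaled_sym gs)) _.
exact: (dvdr_prod_mem id).
Qed.

(** Rescaling permutes the prime powers of which [sr_prod] is the least common multiple, so
    [sr_prod] divides each of its rescalings. The inverse rescaling gives the other divisibility. *)
Lemma sr_prod_rescale a : root_vector r a -> scaled (rescale a sr_prod) sr_prod.
Proof.
have dv b : root_vector r b -> dvdr sr_prod (rescale b sr_prod).
  move=> rb; apply: sr_prod_dvd => i c rc.
  have rbV := root_vectorV rb.
  have := dvdr_morph (@rescale K n b) (orbit_dvd_sr_prod i (root_vectorM rbV rc)).
  by rewrite /= rmorphXn /= -rescaleM (rescaleVK hr rb).
move=> ra; apply: dvdr_scaled; last exact: dv.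
have := dvdr_morph (@rescale K n a) (dv _ (root_vectorV ra)).
by rewrite /= (rescaleVK hr ra).
Qed.

Lemma sr_prod_exponent i : exists2 k, k \in msupp sr_prod & (r %| k i)%N.
Proof.
have nX (g : {mpoly K[n]}) : ~ dvdr 'X_i g -> exists2 k, k \in msupp g & k i = 0%N.
  move=> nd; apply: contrapT => nk; apply: nd; apply/dvdr_mpolyXP => k kg.
  by rewrite lt0n; apply/eqP => k0; apply: nk; exists k.
have [[x xL xi]|nx] := pselect (exists2 x, x \in L & scaled x 'X_i); last first.
  have [|k kT k0] := nX sr_prod; last by exists k; rewrite ?k0 ?dvdn0.
  move=> /(@prime_exp_dvd_sr_prod _ 1 (mpolyX_prime K i) isT)[x [xL xi _]].
  by apply: nx; exists x.
have [g eg] : dvdr ('X_i ^+ r) sr_prod.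
  apply: dvdr_trans (reps_dvd_sr_prod xL); rewrite (sr_mult_variable xi).
  by apply: dvdr_exp; apply: scaled_dvdr; apply: scaled_sym.
(* No prime has multiplicity above [r] in [sr_prod], so ['X_i] does not divide the cofactor [g], and
   some monomial of [g] avoids it. *)
have [[h eh]|k kg k0] := nX g.
  have [|y [_ _]] := @prime_exp_dvd_sr_prod 'X_i r.+1 (mpolyX_prime K i) isT.
    by exists h; rewrite eg eh exprS mulrA.
  by move=> /leq_trans/(_ (sr_mult_le y)); rewrite ltnn.
exists (U_(i) *+ r + k)%MM; last first.
  by rewrite mnmDE mulmnE mnm1E eqxx mul1n k0 addn0.
rewrite eg mpolyXn (perm_mem (msuppMX _ _)).
by apply/mapP; exists k.
Qed.

Lemma sr_prod_subst_pow : exists g, sr_prod = subst_pow r g.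
Proof.
apply: subst_pow_exists => k i kT; have [k0 k0T rk0] := sr_prod_exponent i.
have [z pz] := prim_root_exists K hr.
(* Rescaling only the variable [i] multiplies a monomial by [z] to its exponent of that variable.
   Invariance up to one scalar [c] makes these powers of [z] equal, hence the exponents congruent
   modulo [r]. *)
pose a (j : 'I_n) := if j == i then z else 1.
have ra : root_vector r a.
  by move=> j; rewrite /a; case: ifP; rewrite ?expr1n // (prim_expr_order pz).
have [c c0 ec] := sr_prod_rescale ra.
have zc l : l \in msupp sr_prod -> z ^+ l i = c.
  rewrite mcoeff_msupp => l0; have := congr1 (mcoeff l) ec.
  rewrite mcoeff_rescale mcoeffZ => /(mulIf l0) <-.
  rewrite (bigD1 i) //= /a eqxx big1 ?mulr1 // => j /negbTE->.
  by rewrite expr1n.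
have /eqP := zc k kT; rewrite -(zc k0 k0T) (eq_prim_root_expr pz).
by rewrite (eqP rk0 : k0 i %% r = 0)%N.
Qed.

Lemma sr_prod_squarefree g p : sr_prod = subst_pow r g -> prime_elt p ->
  ~ dvdr (p ^+ 2) g.
Proof.
move=> eg pp [h eh]; have [p0 up _] := pp; set P := subst_pow r p.
have dP : dvdr (P ^+ 2) sr_prod.
  by exists (subst_pow r h); rewrite eg eh rmorphM rmorphXn.
have P0 : P != 0.
  by apply: contraNneq p0 => e; apply/eqP/subst_pow_inj; rewrite rmorph0.
have uP : P \isn't a GRing.unit by apply: contra up; apply: subst_pow_unit.
(* [P] may be reducible, so a prime factor [q] is taken. Its square divides [sr_prod], which forces
   [q] to be a variable. *)
have [q pq qP] := exists_prime_dvd (@mpoly_factorial K n) P0 uP.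
have [x [xL xq /sr_mult_gt1[i xi]]] :
    exists x, [/\ x \in L, scaled x q & (1 < sr_mult x)%N].
  by apply: prime_exp_dvd_sr_prod => //; apply: dvdr_trans dP; apply: dvdr_exp.
have /dvdr_mpolyXP iP : dvdr 'X_i P.
  apply: dvdr_trans qP; apply: scaled_dvdr; apply: scaled_trans xq.
  exact: scaled_sym.
(* The exponents in [P] are [r] times those in [p], so ['X_i] divides [p] as well and is [p] up to
   scaling. *)
have /dvdr_mpolyXP ip : {in msupp p, forall k : 'X_{1..n}, (0 < k i)%N}.
  move=> k; rewrite mcoeff_msupp -(mcoeff_subst_pow p k hr) -mcoeff_msupp => /iP.
  by rewrite mulmnE muln_gt0 => /andP[].
have [c c0 ec] := prime_dvd_scaled (mpolyX_prime K i) pp ip.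
have : dvdr ('X_i ^+ (r * 2)) sr_prod.
  apply: dvdr_trans dP; rewrite exprM; apply: dvdr_exp.
  rewrite (_ : 'X_i ^+ r = c *: P); last first.
    by rewrite /P -linearZ -ec /= subst_powX mpolyXn.
  by exists (c^-1)%:MP; rewrite mul_mpolyC scalerA mulVf // scale1r.
move=> /(prime_exp_dvd_sr_prod (mpolyX_prime K i)); rewrite muln_gt0 hr => /(_ isT).
case=> y [_ _ /leq_trans/(_ (sr_mult_le y))].
by rewrite -{2}[r]muln1 leq_pmul2l.
Qed.

(** The prime factors are rescalings of the [f_ i], and evaluation moves the rescaling to the
    point. *)
Lemma meval_sr_prod (v : 'I_n -> K) : sr_prod.@[v] = 0 <->
  exists i, exists2 a, root_vector r a & (f_ i).@[fun j => a j * v j] = 0.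
Proof.
rewrite /sr_prod rmorph_prod; split=> [/eqP|[i [a ra e]]].
  rewrite prodf_seq_eq0 => /hasP[x xL /=]; rewrite rmorphXn expf_eq0 => /andP[_].
  case: oL => _ _ /(_ x xL)[i [a ra ->]] _.
  by rewrite /= meval_rescale => /eqP; exists i, a.
have [k ek] := orbit_dvd_sr_prod i ra.
have := congr1 (meval v) ek; rewrite rmorphM rmorphXn rmorph_prod /= => ->.
by rewrite meval_rescale e expr0n -[_ == _]negbK -lt0n sr_mult_gt0 mulr0.
Qed.

Lemma sr_prod_homog : (forall i, exists d, f_ i \is d.-homog) ->
  exists d, sr_prod \is d.-homog.
Proof.
move=> hf; rewrite /sr_prod big_seq.
apply: (big_ind (fun g : {mpoly K[n]} => exists d, g \is d.-homog)).
- by exists 0%N; apply: dhomog1.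
- by move=> g h [d gd] [e he]; exists (d + e)%N; apply: dhomogM.
case: oL => _ _ dL _ x /dL[i [a ra ->]]; have [d hd] := hf i.
by exists (d * sr_mult (rescale a (f_ i)))%N; apply/dhomogMn/dhomog_rescale.
Qed.

End Family.
End Orbits.

(** * Zero loci and the power map *)

Lemma meval_homog (K : fieldType) n d (f : {mpoly K[n]}) c (v : 'I_n -> K) :
  f \is d.-homog -> f.@[fun i => c * v i] = c ^+ d * f.@[v].
Proof.
move=> /dhomogP h; rewrite !mevalE mulr_sumr big_seq [RHS]big_seq.
apply: eq_bigr => m /h <-; rewrite mulrCA; congr (_ * _).
under eq_bigr do rewrite exprMn.
by rewrite big_split /= prodrXr -mdegE.
Qed.

Lemma zero_locus_pi (K : fieldType) n d (f : {mpoly K[n.+1]}) (x : hvec K n) :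
  f \is d.-homog -> zero_locus f (\pi_(proj K n) x) <-> f.@[val x 0] = 0.
Proof.
move=> hf; have /eqmodP/hvec_eqP[c c0 e] := reprK (\pi_(proj K n) x).
rewrite /zero_locus /= (@meval_eq _ _ _ (fun i => c * val x 0 i)); last first.
  by move=> i; rewrite e mxE.
rewrite (meval_homog _ _ hf); split=> [/eqP|->]; last by rewrite mulr0.
by rewrite mulf_eq0 expf_eq0 (negbTE c0) andbF => /eqP.
Qed.

(** The origin is not a projective point, so it needs its own argument when projective zeros are
    turned into affine ones. *)
Lemma meval0_homog (K : fieldType) n d (f : {mpoly K[n]}) (v : 'I_n -> K) :
  (0 < d)%N -> f \is d.-homog -> (forall i, v i = 0) -> f.@[v] = 0.
Proof.
move=> d0 hf v0; rewrite (@meval_eq _ _ _ (fun i => 0 * v i)); last first.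
  by move=> i; rewrite v0 mul0r.
by rewrite (meval_homog _ _ hf) expr0n eqn0Ngt d0 mul0r.
Qed.

(** * Hypersurfaces, their equations and their power images *)

Section Hypersurfaces.
Variables (K : numClosedFieldType) (n : nat).
Implicit Types (f g h p : {mpoly K[n.+1]}).

Lemma square_free_neq0 f : square_free f -> f != 0.
Proof.
move=> sf; apply/eqP => f0; have [_ /negP[]] := mpolyX_prime K (ord0 : 'I_n.+1).
by apply: sf; exists 0; rewrite mul0r.
Qed.

Lemma square_freeP f : f != 0 ->
  square_free f <-> forall p, prime_elt p -> ~ dvdr (p ^+ 2) f.
Proof.
move=> f0; split=> [sf p [_ /negP up _] d|sf p [k ek]].
  by apply: up; apply: sf.
have p0 : p != 0 by apply: contraNneq f0 => p0; rewrite ek p0 expr0n mulr0.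
apply: contrapT => /negP up.
have [q pq qp] := exists_prime_dvd (@mpoly_factorial K _) p0 up.
by case: (sf q pq); rewrite ek; apply/dvdr_mull/dvdr_exp.
Qed.

Lemma hypersurface_nonunit f : hypersurface_eq f -> f \isn't a GRing.unit.
Proof.
move=> [sf [d d0 hd]]; apply/negP => /mpoly_unitP[c c0 e].
have h0 : f \is 0.-homog by rewrite e -[c%:MP]mulr1 mul_mpolyC dhomogZ ?dhomog1.
by rewrite (dhomog_uniq (square_free_neq0 sf) hd h0) in d0.
Qed.

(** Zeros of a prime factor of [h] are zeros of [g], so that factor divides [g]; square-freeness of
    [h] assembles the factors. *)
Lemma zero_locus_dvd h g : hypersurface_eq h -> hypersurface_eq g ->
  (zero_locus h `<=` zero_locus g)%classic -> dvdr h g.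
Proof.
move=> [sh [d d0 hd]] [sg [e e0 he]] hg; have h0 := square_free_neq0 sh.
apply: (squarefree_dvd (@mpoly_factorial K _) h0).
  by apply/square_freeP.
move=> p pp [k ek]; apply: prime_dvd_zeros => // v pv.
have hv : h.@[v] = 0 by rewrite ek mevalM pv mulr0.
pose w : 'rV[K]_n.+1 := \row_i v i.
have wE i : w 0 i = v i by rewrite mxE.
have [w0|w0] := eqVneq w 0.
  by apply: (meval0_homog e0 he) => i; rewrite -wE w0 mxE.
pose x : hvec K n := exist _ w w0.
have := hg (\pi_(proj K n) x); rewrite (zero_locus_pi _ hd) (zero_locus_pi _ he).
by rewrite /= (meval_eq h wE) (meval_eq g wE); apply.
Qed.

Lemma hypersurface_zero_locus_inj h g : hypersurface_eq h -> hypersurface_eq g ->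
  zero_locus h = zero_locus g -> scaled h g.
Proof.
by move=> hh hg e; apply: dvdr_scaled; apply: zero_locus_dvd; rewrite // e.
Qed.

Lemma hypersurface_scaled h g : scaled h g -> hypersurface_eq g ->
  hypersurface_eq h.
Proof.
move=> s [sg [d d0 hd]]; split; last by exists d => //; apply: dhomog_scaled s hd.
move=> p dp; apply: sg; apply: dvdr_trans dp _.
exact: scaled_dvdr.
Qed.

Lemma zero_locus_scaled h g : scaled h g -> zero_locus h = zero_locus g.
Proof.
move=> [c c0 ->]; apply/seteqP; split=> p; rewrite /zero_locus /= mevalZ.
  by move/eqP; rewrite mulf_eq0 (negbTE c0) => /eqP.
by move=> ->; rewrite mulr0.
Qed.

Lemma prime_factorization f : f != 0 -> f \isn't a GRing.unit ->
  exists m (f_ : 'I_m -> {mpoly K[n.+1]}),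
    (forall i, prime_elt (f_ i)) /\ f = \prod_i f_ i.
Proof.
move=> f0 uf; have [u [[|x l] [uu pl e]]] := mpoly_factorial f0.
  by rewrite e big_nil mulr1 uu in uf.
(* The unit is absorbed into the first prime so that the product equals [f] exactly. *)
exists (size (u * x :: l)), (tnth (in_tuple (u * x :: l))); split=> [i|].
  have := mem_tnth i (in_tuple (u * x :: l)).
  rewrite in_cons => /predU1P[->|il]; last by apply: pl; rewrite in_cons il orbT.
  have [c c0 ->] := mpoly_unitP uu; apply: (@scaled_prime _ _ _ x).
    by exists c; rewrite // mul_mpolyC.
  by apply: pl; rewrite mem_head.
by rewrite -(big_tnth _ _ _ predT id) e !big_cons mulrA.
Qed.

Lemma is_lcm_uniq m (q : 'I_m -> {mpoly K[n.+1]}) s t :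
  is_lcm q s -> is_lcm q t -> scaled s t.
Proof. by move=> [qs ms] [qt mt]; apply: dvdr_scaled; [apply: ms | apply: mt]. Qed.

Variables (r : nat) (hr : (0 < r)%N).

Lemma is_sr_exists f : hypersurface_eq f -> exists s, is_sr r f s.
Proof.
move=> hf; have [sf _] := hf.
have [m [f_ [pf ef]]] :=
  prime_factorization (square_free_neq0 sf) (hypersurface_nonunit hf).
have /boolp.choice[s_ hs] i := is_sr_irr_exists hr (f_ i).
have [L oL] := orbit_reps_exist hr f_.
exists (sr_prod r L), m, f_, s_; split=> //.
  by move=> i; apply/mirreducible_prime.
exact: (is_lcm_sr_prod hr pf oL hs).
Qed.

Section PowerImage.
Variables (m : nat) (f_ : 'I_m -> {mpoly K[n.+1]}) (L : seq {mpoly K[n.+1]}).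
Variables (f g : {mpoly K[n.+1]}).
Hypotheses (pf : forall i, prime_elt (f_ i)) (oL : orbit_reps r f_ L).
Hypotheses (hf : hypersurface_eq f) (ef : f = \prod_i f_ i).
Hypothesis eg : sr_prod r L = subst_pow r g.

Lemma factor_homog i : exists d, f_ i \is d.-homog.
Proof.
have [sf [d d0 hd]] := hf; apply: (dhomog_dvd (square_free_neq0 sf) hd).
by rewrite ef (bigD1 i) //=; apply/dvdr_mulr/dvdr_refl.
Qed.

Lemma power_image_hypersurface : hypersurface_eq g.
Proof.
have T0 : sr_prod r L != 0 := sr_prod_neq0 hr pf oL.
have g0 : g != 0 by apply: contraNneq T0 => g0; rewrite eg g0 rmorph0.
split.
  by apply/square_freeP => // p; apply: (sr_prod_squarefree hr pf oL eg).
have [d hd] := sr_prod_homog oL factor_homog.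
rewrite eg in hd; have {}hd := dhomog_subst_pow hr hd; exists (d %/ r)%N => //.
(* In degree 0 the product [sr_prod r L] would be a unit, hence so would every [f_ i] and [f]
   itself. *)
rewrite lt0n; apply/negP => /eqP e; rewrite e in hd.
have [c c0 ec] := mpoly_unitP (dhomog0_unit g0 hd).
have uT : sr_prod r L \is a GRing.unit.
  by rewrite eg ec /subst_pow comp_mpolyC mpolyC_unit.
have := hypersurface_nonunit hf; rewrite ef => /negP; apply.
apply: rpred_prod => i _.
have := orbit_dvd_sr_prod hr oL i (@root_vector1 K n.+1 r).
by rewrite rescale1 => /(dvdr_unit uT); rewrite unitrX_pos // (sr_mult_gt0 hr).
Qed.

Lemma power_image_zero_locus :
  zero_locus g = (@coord_pow K n r @` zero_locus f)%classic.
Proof.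
have [_ [d d0 hd]] := power_image_hypersurface; have [_ [e _ he]] := hf.
have fE v : f.@[v] = 0 <-> exists i, (f_ i).@[v] = 0.
  rewrite ef rmorph_prod; split=> [/eqP|[i ei]].
    by rewrite prodf_seq_eq0 => /hasP[i _ /eqP]; exists i.
  by rewrite (bigD1 i) //= ei mul0r.
have gE v : g.@[fun i => v i ^+ r] = (sr_prod r L).@[v].
  by rewrite eg meval_subst_pow.
apply/seteqP; split=> [p gp|_ [p fp <-]].
  have hroot y : exists x : K, x ^+ r = y.
    have [x] := @solve_monicpoly K r (fun i => if i == 0%N then y else 0) hr.
    rewrite (bigD1 (Ordinal hr)) //= mulr1 big1 ?addr0; first by exists x.
    by move=> i; rewrite -val_eqE /= => /negbTE->; rewrite mul0r.
  (* Arbitrary coordinate-wise roots [v] of [p] need not lie on V(f), but some rescaling [w] of [v]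
     does, and it has the same [r]-th powers. *)
  have /boolp.choice[v hv] i := hroot (val (repr p) 0 i).
  have : (sr_prod r L).@[v] = 0 by rewrite -gE (meval_eq g hv).
  move/(meval_sr_prod hr oL) => [i [a ra ei]].
  pose w : 'rV[K]_n.+1 := \row_j (a j * v j).
  have wr j : w 0 j ^+ r = val (repr p) 0 j by rewrite mxE exprMn ra mul1r hv.
  have w0 : w != 0.
    apply: contraTneq (valP (repr p)) => w0; rewrite negbK; apply/eqP/rowP => j.
    by rewrite -wr w0 !mxE expr0n eqn0Ngt hr.
  pose x : hvec K n := exist _ w w0; exists (\pi_(proj K n) x).
    apply/(zero_locus_pi _ he)/fE; exists i; rewrite -ei; apply: meval_eq => j.
    by rewrite /= mxE.
  rewrite coord_pow_pi -[RHS]reprK; congr (\pi_(proj K n) _); apply: val_inj.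
  by apply/rowP => j; rewrite mxE wr.
rewrite -[p]reprK coord_pow_pi; apply/(zero_locus_pi _ hd).
rewrite (@meval_eq _ _ _ (fun i => val (repr p) 0 i ^+ r)); last first.
  by move=> i; rewrite mxE.
rewrite gE; apply/(meval_sr_prod hr oL).
have /fE[i ei] := fp; exists i, (fun=> 1); first exact: root_vector1.
by rewrite -ei; apply: meval_eq => j; rewrite mul1r.
Qed.

End PowerImage.

Theorem coordinate_power_equation f : hypersurface_eq f ->
  (exists s, is_sr r f s) /\
  (forall s, is_sr r f s -> exists g, s = subst_pow r g /\
     forall h, is_coord_power r f h <-> scaled h g).
Proof.
move=> hf; split=> [|s [m [f_ [s_ [irf ef hs ls]]]]]; first exact: is_sr_exists.
have pf i : prime_elt (f_ i) by apply/mirreducible_prime.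
have [L oL] := orbit_reps_exist hr f_.
have lT := is_lcm_sr_prod hr pf oL hs.
have [g eg] := sr_prod_subst_pow hr pf oL.
(* Least common multiples agree up to a scalar [c], which is moved into the witness [c *: g]. *)
have [c c0 es] := is_lcm_uniq ls lT.
have hg := power_image_hypersurface pf oL hf ef eg.
have zg := power_image_zero_locus pf oL hf ef eg.
have cg : scaled (c *: g) g by exists c.
exists (c *: g); split; first by rewrite linearZ /= -eg.
move=> h; split=> [[hh zh]|hc].
  apply: scaled_trans (scaled_sym cg).
  by apply: hypersurface_zero_locus_inj; rewrite // zh.
have sg := scaled_trans hc cg.
by split; [apply: hypersurface_scaled sg hg | rewrite (zero_locus_scaled sg)].
Qed.

End Hypersurfaces.

(** A [realType] is a model of the real numbers, so [R[i]] is the field of complex numbers. *)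
Theorem proposition3p4 (R : realType) (n r : nat) (f : {mpoly R[i][n.+1]})
    (hr : (0 < r)%N) (hf : hypersurface_eq f) :
  (exists s : {mpoly R[i][n.+1]}, is_sr r f s) /\
  (forall s : {mpoly R[i][n.+1]}, is_sr r f s ->
     exists g : {mpoly R[i][n.+1]}, s = subst_pow r g /\
       forall h : {mpoly R[i][n.+1]}, is_coord_power r f h <-> scaled h g).
Proof. exact: (@coordinate_power_equation R[i] n r hr f hf). Qed.
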